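(* Let $(X,\mathcal F)$ be a measurable space, let $v$ be a capacity on $\mathcal F$, and let $\hat v$ be its totally balanced cover. Then the following two conditions are equivalent: (i) $\lim_n\int^{Cav}_X f_n\,dv=\int^{Cav}_X f\,dv$ for every increasing sequence $\{f_n\}_n\subset\mathcal M$ converging pointwise to a function $f\in\mathcal M$; (ii) $\hat v$ is continuous from below.
   Context: $\mathcal M$ is the collection of all nonnegative $\mathcal F$-measurable functions on $X$. A capacity is a finite set function $v:\mathcal F\to[0,\infty)$ with $v(\emptyset)=0$ and $v(F)\le v(E)$ whenever $F\subseteq E$. The concave integral of $f\in\mathcal M$ with respect to $v$ is $\int^{Cav}_X f\,dv:=\sup\{\sum_{i=1}^N\lambda_i v(F_i): \sum_{i=1}^N\lambda_i \mathbf 1_{F_i}\le f,\ F_i\in\mathcal F,\ \lambda_i\ge 0,\ N\in\mathbb N\}$, where $\mathbf 1_F$ is the characteristic function of $F$. The totally balanced cover of $v$ is the set function $\hat v(F):=\int^{Cav}_X\mathbf 1_F\,dv$, $F\in\mathcal F$. A sequence $\{f_n\}_n$ is increasing if $f_n\le f_{n+1}$ pointwise for all $n$. A monotone set function $w$ on $\mathcal F$ is continuous from below if $\lim_n w(F_n)=w(\bigcup_n F_n)$ for every increasing sequence $F_1\subseteq F_2\subseteq\cdots$ in $\mathcal F$. *)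

(* Defs.v *)
From HB Require Import structures.
From mathcomp Require Import all_boot all_order all_algebra.
From mathcomp Require Import all_classical all_reals all_analysis.
Set Implicit Arguments.
Unset Strict Implicit.
Unset Printing Implicit Defensive.
Import Order.TTheory GRing.Theory Num.Theory.
Import numFieldNormedType.Exports.
Local Open Scope classical_set_scope.
Local Open Scope ring_scope.

Section ConcaveIntegral.
Context {d : measure_display} {T : measurableType d} {R : realType}.

Definition nonneg_measurable (f : T -> R) : Prop :=
  measurable_fun setT f /\ forall x, 0 <= f x.

(* A set function on the sigma-algebra is a function on all of [set T] whose
   values on non-measurable sets are never constrained nor used. *)
Definition capacity (v : set T -> R) : Prop :=
  [/\ v set0 = 0,
      forall F, measurable F -> 0 <= v F &
      forall F E, measurable F -> measurable E -> F `<=` E -> v F <= v E].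

(* Although v is finite, the supremum may be +oo (e.g. on the discrete space of
   natural numbers with v F = 1 for every nonempty F and f = 1). *)
Definition concave_integral (v : set T -> R) (f : T -> R) : \bar R :=
  ereal_sup [set s : \bar R |
    exists (N : nat) (lambda : 'I_N -> R) (F : 'I_N -> set T),
      [/\ forall i, 0 <= lambda i,
          forall i, measurable (F i),
          forall x, \sum_(i < N) lambda i * \1_(F i) x <= f x &
          s = (\sum_(i < N) lambda i * v (F i))%:E]].

Definition totally_balanced_cover (v : set T -> R) (F : set T) : \bar R :=
  concave_integral v \1_F.

Definition continuous_from_below (w : set T -> \bar R) : Prop :=
  forall F : nat -> set T,
    (forall n, measurable (F n)) ->
    (forall n, F n `<=` F n.+1) ->
    w (F n) @[n --> \oo] --> w (\bigcup_n F n).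

End ConcaveIntegral.

(* Main.v *)
Require Import Defs.
From HB Require Import structures.
From mathcomp Require Import all_boot all_order all_algebra.
From mathcomp Require Import all_classical all_reals all_analysis.
From mathcomp Require Import measurable_realfun.
Set Implicit Arguments.
Unset Strict Implicit.
Unset Printing Implicit Defensive.
Import Order.TTheory GRing.Theory Num.Theory.
Import numFieldNormedType.Exports.
Local Open Scope classical_set_scope.
Local Open Scope ring_scope.

(** Condition (ii) is condition (i) for the characteristic functions of an
increasing sequence of sets, because these converge pointwise to the
characteristic function of the union ([cvg_indic_bigcup]).

For the converse only one inequality is at stake, since the concave integral
is monotone: every sum [\sum_i lambda i * v (F i)] admitted for [f] must be at
most the supremum of the integrals of the [f_ n].  Write
[s = \sum_i lambda i * \1_(F i) <= f], fix [0 < c < 1] and let [E n] be the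
set where [c * s <= f_ n].  These sets increase to the whole space: at a point
where [s] is positive, [c * s < s <= f], so that [f_ n] eventually exceeds
[c * s] ([bigcup_superlevel]).  Everywhere on the space,
[c * \sum_i lambda i * \1_(F i `&` E n) <= f_ n], and the concave integral is
positively homogeneous and superadditive ([concave_integral_sum]), hence
[c * \sum_i lambda i * v^(F i `&` E n)] is at most the integral of [f_ n],
where [v^] is the totally balanced cover.  Continuity of [v^] from below turns
the left-hand side into [c * \sum_i lambda i * v^(F i)] in the limit, and
[v <= v^].  Letting [c] tend to 1 concludes.

With [v] in place of [v^] the lower bound for the integral of [f_ n] would be
immediate, but nothing would be known about the limit of [v (F i `&` E n)];
it is the superadditivity of the integral that gives the bound for [v^]. *)

Section ConcaveIntegralTheory.
Context {d : measure_display} {X : measurableType d} {R : realType}.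
Implicit Types (v : set X -> R) (f g : X -> R).

Lemma concave_integral_ubound v f N (lambda : 'I_N -> R) (F : 'I_N -> set X) :
  (forall i, 0 <= lambda i) -> (forall i, measurable (F i)) ->
  (forall x, \sum_(i < N) lambda i * \1_(F i) x <= f x) ->
  ((\sum_(i < N) lambda i * v (F i))%:E <= concave_integral v f)%E.
Proof.
by move=> l0 mF Ff; apply: ereal_sup_ubound; exists N, lambda, F; split.
Qed.

Lemma concave_integral_ge0 v f :
  (forall x, 0 <= f x) -> (0 <= concave_integral v f)%E.
Proof.
move=> f0.
(* the empty sum is admissible *)
have := @concave_integral_ubound v f 0 (fun=> 0) (fun=> set0).
by rewrite big_ord0; apply=> // x; rewrite big_ord0.
Qed.

Lemma le_concave_integral v f g :
  (forall x, f x <= g x) -> (concave_integral v f <= concave_integral v g)%E.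
Proof.
move=> fg; apply: ge_ereal_sup => _ [N [l [F [l0 mF lf ->]]]].
by apply: concave_integral_ubound => // x; exact: le_trans (fg x).
Qed.

Lemma concave_integralZ v f (c : R) : 0 <= c -> (forall x, 0 <= f x) ->
  (c%:E * concave_integral v f <= concave_integral v (fun x => (c * f x)%R))%E.
Proof.
rewrite le_eqVlt => /predU1P[<-|c0] f0.
  by rewrite mul0e concave_integral_ge0// => x; rewrite mul0r.
rewrite -lee_pdivlMl//; apply: ge_ereal_sup => _ [N [l [F [l0 mF lf ->]]]].
rewrite lee_pdivlMl// -EFinM mulr_sumr; under eq_bigr do rewrite mulrA.
apply: concave_integral_ubound => // [i|x]; first by rewrite mulr_ge0// ltW.
under eq_bigr do rewrite -mulrA.
by rewrite -mulr_sumr ler_pM2l.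
Qed.

(** Superadditivity: the concatenation of admissible families for [f] and [g]
is admissible for [f + g]. The two suprema are taken one after the other,
moving to the other side a term that has to be finite; an infinite integral of
[g] is treated apart. *)
Lemma concave_integralD v f g :
  (forall x, 0 <= f x) -> (forall x, 0 <= g x) ->
  (concave_integral v f + concave_integral v g <=
   concave_integral v (fun x => (f x + g x)%R))%E.
Proof.
move=> f0 g0.
have admissible_add N (l : 'I_N -> R) (F : 'I_N -> set X) : (forall i, 0 <= l i) ->
    (forall i, measurable (F i)) ->
    (forall x, \sum_(i < N) l i * \1_(F i) x <= f x) ->
    ((\sum_(i < N) l i * v (F i))%:E + concave_integral v g <=
     concave_integral v (fun x => (f x + g x)%R))%E.
  move=> l0 mF lf; rewrite -leeBrDl//.
  apply: ge_ereal_sup => _ [M [m [G [m0 mG mg ->]]]].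
  rewrite leeBrDl// -EFinD.
  pose lm i := match fintype.split i with inl j => l j | inr k => m k end.
  pose FG i := match fintype.split i with inl j => F j | inr k => G k end.
  have split_sum (h : set X -> R) : \sum_(i < N + M) lm i * h (FG i) =
      \sum_(i < N) l i * h (F i) + \sum_(i < M) m i * h (G i).
    rewrite big_split_ord/=; congr (_ + _); apply: eq_bigr => i _.
      by rewrite /lm /FG (unsplitK (inl i)).
    by rewrite /lm /FG (unsplitK (inr i)).
  rewrite -split_sum; apply: concave_integral_ubound.
  - by move=> i; rewrite /lm; case: fintype.split.
  - by move=> i; rewrite /FG; case: fintype.split.
  - by move=> x; rewrite (split_sum (fun A => \1_A x)) lerD.
have [gfin|] := boolP (concave_integral v g \is a fin_num).
  rewrite -leeBrDr//; apply: ge_ereal_sup => _ [N [l [F [l0 mF lf ->]]]].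
  by rewrite leeBrDr//; exact: admissible_add.
(* If the integral of g is infinite, then so is that of f + g. *)
rewrite ge0_fin_numE ?concave_integral_ge0// -leNgt leye_eq => /eqP goo.
suff -> : concave_integral v (fun x => (f x + g x)%R) = +oo%E by rewrite leey.
apply/eqP; rewrite -leye_eq -goo; apply: le_concave_integral => x.
by rewrite lerDr.
Qed.

Lemma concave_integral_sum v N (lambda : 'I_N -> R) (f : 'I_N -> X -> R) :
  (forall i, 0 <= lambda i) -> (forall i x, 0 <= f i x) ->
  (\sum_(i < N) (lambda i)%:E * concave_integral v (f i) <=
   concave_integral v (fun x => (\sum_(i < N) lambda i * f i x)%R))%E.
Proof.
elim: N lambda f => [|N IH] l f l0 f0.
  by rewrite big_ord0 concave_integral_ge0// => x; rewrite big_ord0.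
under [X in (_ <= concave_integral v X)%E]eq_fun do rewrite big_ord_recr.
rewrite big_ord_recr/=.
apply: le_trans (concave_integralD _ _ _) => [|x|x]; last 2 first.
- by apply: sumr_ge0 => i _; rewrite mulr_ge0.
- by rewrite mulr_ge0.
by apply: leeD; [exact: IH|exact: concave_integralZ].
Qed.

Lemma totally_balanced_cover_ge v F : measurable F ->
  ((v F)%:E <= totally_balanced_cover v F)%E.
Proof.
move=> mF.
have := @concave_integral_ubound v \1_F 1 (fun=> 1) (fun=> F).
by rewrite big_ord1 mul1r; apply=> // x; rewrite big_ord1 mul1r.
Qed.

Lemma cvg_indic_bigcup (F : nat -> set X) (x : X) :
  (forall n, F n `<=` F n.+1) ->
  \1_(F n) x @[n --> \oo] --> (\1_(\bigcup_n F n) x : R).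
Proof.
move=> ndF; apply: cvg_near_cst.
have [[m _ Fmx]|nFx] := pselect ((\bigcup_n F n) x).
  exists m => // n /= mn; rewrite !indicE !mem_set//; first by exists m.
  have /nondecreasing_seqP/(_ _ _ mn) : forall k, (F k <= F k.+1)%O.
    by move=> k; apply/subsetPset; exact: ndF.
  by move/subsetPset; exact.
exists 0%N => // n _ /=; rewrite !indicE !memNset// => Fnx.
by apply: nFx; exists n.
Qed.

(** Shrinking [s] by a factor [c < 1] is what makes the superlevel sets
exhaust the space: where [f x = s x], the sequence may stay below [s x]. *)
Lemma bigcup_superlevel (f_ : nat -> X -> R) f (s : X -> R) (c : R) :
  0 < c < 1 -> (forall n x, 0 <= f_ n x) ->
  (forall x, f_ n x @[n --> \oo] --> f x) -> (forall x, 0 <= s x <= f x) ->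
  \bigcup_n [set x | c * s x <= f_ n x] = setT.
Proof.
move=> /andP[c0 c1] f_0 f_f sf; apply/seteqP; split => // x _.
have /andP[] := sf x; rewrite le_eqVlt => /predU1P[sx0 _|s0 sfx].
  by exists 0%N => //=; rewrite -sx0 mulr0.
have csf : c * s x < f x by rewrite (lt_le_trans _ sfx)// gtr_pMl.
have [n _ /(_ n (leqnn n)) csfn] := cvgr_gt _ (f_f x) _ csf.
by exists n => //=; exact: ltW.
Qed.

(** The inequality that carries the converse. Each set [F i] is cut down to the
part where [f_ n] already exceeds a shrunken copy of the simple function; this
loses nothing in the limit because the cover is continuous from below. Both the
integrals and the cover may be infinite, so the limit is taken among extended
reals, with nonnegative summands. *)
Lemma admissible_sum_le_limit v (f_ : nat -> X -> R) f (L : \bar R)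
    N (lambda : 'I_N -> R) (F : 'I_N -> set X) :
  capacity v -> continuous_from_below (totally_balanced_cover v) ->
  (forall n, nonneg_measurable (f_ n)) ->
  (forall n x, f_ n x <= f_ n.+1 x) ->
  (forall x, f_ n x @[n --> \oo] --> f x) ->
  (forall n, concave_integral v (f_ n) <= L)%E ->
  (forall i, 0 <= lambda i) -> (forall i, measurable (F i)) ->
  (forall x, \sum_(i < N) lambda i * \1_(F i) x <= f x) ->
  ((\sum_(i < N) lambda i * v (F i))%:E <= L)%E.
Proof.
move=> [_ v0 _] vcont mf_ ndf_ f_f fL l0 mF sf.
pose s x := \sum_(i < N) lambda i * \1_(F i) x.
have s0 x : 0 <= s x by apply: sumr_ge0 => i _; rewrite mulr_ge0.
(* It is enough to bound c times the sum, for every c strictly below 1. *)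
apply/lee_mul01Pr; first by rewrite lee_fin sumr_ge0// => i _; rewrite mulr_ge0 ?v0.
move=> c /[dup] c01 /andP[c0 c1].
pose E n := [set x | c * s x <= f_ n x].
have mE n : measurable (E n).
  rewrite -[E n]setTI; apply: measurable_fun_le => //; last exact: (mf_ n).1.
  apply: measurable_funM => //; apply: measurable_sum => i.
  by apply: measurable_funM => //; exact: measurable_indic.
have ET : \bigcup_n E n = setT.
  apply: bigcup_superlevel c01 _ f_f _ => [n x|x]; first exact: (mf_ n).2.
  by rewrite s0 sf.
have vFE i : totally_balanced_cover v (F i `&` E n) @[n --> \oo] -->
    totally_balanced_cover v (F i).
  rewrite -[X in _ --> totally_balanced_cover v X]setIT -ET setI_bigcupr.
  apply: vcont => n; first exact: measurableI.
  by apply: setIS => x /le_trans; apply.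
have sum_cvg : (\sum_(i < N) (c * lambda i)%:E *
      totally_balanced_cover v (F i `&` E n))%E @[n --> \oo] -->
    (\sum_(i < N) (c * lambda i)%:E * totally_balanced_cover v (F i))%E.
  apply: cvg_nnesum => i _; last exact: cvgeZl.
  apply: nearW => n; rewrite mule_ge0 ?lee_fin ?mulr_ge0 ?(ltW c0)//.
  exact: concave_integral_ge0.
apply: (@le_trans _ _
    (\sum_(i < N) (c * lambda i)%:E * totally_balanced_cover v (F i))%E).
  rewrite -EFinM mulr_sumr -sumEFin; apply: lee_sum => i _.
  rewrite mulrA EFinM lee_wpmul2l ?lee_fin ?mulr_ge0 ?(ltW c0)//.
  exact: totally_balanced_cover_ge.
rewrite -(cvg_lim _ sum_cvg)//; apply: lime_le; first exact: cvgP sum_cvg.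
apply: nearW => n; apply: le_trans (fL n).
apply: le_trans (concave_integral_sum _ _ _) _ => [i|i x|].
- by rewrite mulr_ge0 ?(ltW c0).
- by [].
(* On E n this is the definition of E n; elsewhere the left-hand side is 0. *)
apply: le_concave_integral => x; have [xE|xE] := pselect (E n x).
  apply: le_trans (xE); rewrite /s mulr_sumr; apply: ler_sum => i _.
  by rewrite indicI/= [\1_(E n) x]indicE mem_set// mulr1 mulrA.
rewrite big1 ?(mf_ n).2// => i _.
by rewrite indicI/= [\1_(E n) x]indicE memNset// !mulr0.
Qed.

End ConcaveIntegralTheory.

Theorem theorem6 (R : realType) (d : measure_display) (X : measurableType d)
    (v : set X -> R) (hv : capacity v) :
  (forall (f_ : nat -> X -> R) (f : X -> R),
      (forall n, nonneg_measurable (f_ n)) ->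
      nonneg_measurable f ->
      (forall n x, f_ n x <= f_ n.+1 x) ->
      (forall x, f_ n x @[n --> \oo] --> f x) ->
      concave_integral v (f_ n) @[n --> \oo] --> concave_integral v f)
  <-> continuous_from_below (totally_balanced_cover v).
Proof.
split=> [cvg_int F mF ndF|vcont f_ f mf_ mf ndf_ f_f].
  apply: cvg_int => [n||n x|x]; last exact: cvg_indic_bigcup.
  - by split=> //; exact: measurable_indic.
  - by split=> //; apply: measurable_indic; exact: bigcup_measurable.
  - rewrite !indicE ler_nat; case: (boolP (x \in F n)) => // /set_mem /ndF.
    by move=> Fx; rewrite mem_set.
have f_le n x : f_ n x <= f x.
  rewrite -(cvg_lim _ (f_f x))//.
  apply: (@nondecreasing_cvgn_le _ (f_ ^~ x)); last exact: cvgP (f_f x).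
  by apply/nondecreasing_seqP => k; exact: ndf_.
suff -> : concave_integral v f =
    ereal_sup (range (fun n => concave_integral v (f_ n))).
  apply: ereal_nondecreasing_cvgn; apply/nondecreasing_seqP => n.
  exact: le_concave_integral.
apply/eqP; rewrite eq_le; apply/andP; split.
  apply: ge_ereal_sup => _ [N [l [F [l0 mF lf ->]]]].
  apply: (admissible_sum_le_limit hv vcont mf_ ndf_ f_f) => // n.
  by apply: ereal_sup_ubound; exists n.
apply: ge_ereal_sup => _ [n _ <-]; exact: le_concave_integral.
Qed.
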